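(* Let $\psi(z) = \sum_{k=0}^n a_k z^k = \prod_{k=1}^n (1+\rho_k z)$, where $\rho_k > 0$ for $1 \le k \le n$, be a real polynomial with all real negative zeros, and set $a_k = 0$ for $k \notin \{0,1,\dots,n\}$. Let $p$ be a positive integer and, for $0\le k\le n$, let $$L_k^p := \binom{2p-1}{p} a_k^2 + \sum_{j=1}^p (-1)^j \binom{2p}{p-j} a_{k-j}a_{k+j}.$$ Then the zeros of the polynomial $$L_k^p[\psi(z)] := \sum_{k=0}^n L_k^p\, z^k$$ are all real and negative.
   Context: For a polynomial $\psi(x)=\sum_k a_k x^k$, the convention is that $a_k=0$ whenever $k\notin\{0,1,\dots,\deg\psi\}$. The notation $L_k^p[\psi(z)]$ denotes the polynomial $\sum_{k=0}^n L_k^p z^k$ obtained by applying the non-linear operator $a_k \mapsto L_k^p$ to the coefficients of $\psi$ (here $k$ is a summation index). *)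

(* Defs.v *)
From HB Require Import structures.
From mathcomp Require Import all_boot all_order all_algebra.
From mathcomp Require Import reals complex.

Set Implicit Arguments.
Unset Strict Implicit.
Unset Printing Implicit Defensive.

Import Order.TTheory GRing.Theory Num.Theory.

Local Open Scope ring_scope.

(* The k-th coefficient for an arbitrary integer k. Indices such as k - j are
   computed in int, not with the truncated subtraction of nat, so a negative
   index gives 0; q`_m is already 0 beyond the degree. *)
Definition coefz (R : nzRingType) (q : {poly R}) (k : int) : R :=
  if k is Posz m then q`_m else 0.

Definition Lcoef (R : nzRingType) (p : nat) (q : {poly R}) (k : nat) : R :=
  'C(2 * p - 1, p)%:R * coefz q k%:Z ^+ 2
  + \sum_(1 <= j < p.+1) (-1) ^+ j * 'C(2 * p, p - j)%:R
      * (coefz q (k%:Z - j%:Z) * coefz q (k%:Z + j%:Z)).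

(* Main.v *)
(* Let z be a zero; z is not 0 as L_0 > 0. If z is not negative, then z = x^2 with
   Re x > 0, and with f(s) = prod_i (1 + rho_i^2 x^2 + rho_i x s) the identity
     psi(x w) psi(x / w) = f(w + 1/w)
   together with von Szily's identity
     sum_j (-1)^j C(2p, p+j) C(2r, r+j) = (2p)! (2r)! / (p! r! (p+r)!)
   turns the value of the polynomial at z into a nonzero multiple of J(D^2) f (0),
   where D is differentiation and J(u) = sum_r u^r / (r! (p+r)!).
   All zeros -(1/(rho_i x) + rho_i x) of f lie in Re s < 0. An operator D + i k with
   k real preserves every half-plane Re s <= h containing the zeros (Gauss-Lucas
   style), hence so does q(D^2) when q has only negative zeros. J is a limit of such
   q (Laguerre polynomials, which occur in (D + lam)^N X^(p+N)), and |q(D^2) f (0)|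
   stays bounded below because its zeros keep away from 0. *)

Require Import Defs.
From HB Require Import structures.
From mathcomp Require Import all_boot all_order all_algebra.
From mathcomp Require Import reals complex.
From mathcomp Require Import zify ring.

Set Implicit Arguments.
Unset Strict Implicit.
Unset Printing Implicit Defensive.

Import Order.TTheory GRing.Theory Num.Theory.

Local Open Scope ring_scope.

(** * Half-planes of roots under the operator [D + lam] *)

(** The factor [u] rotates the half-plane: [u = 1] bounds real parts, [u = 'i] and [u = - 'i] bound
    imaginary parts from below and from above. *)
Definition half_plane (C : numClosedFieldType) (u h : C) (f : {poly C}) : Prop :=
  forall z, root f z -> 'Re (u * z) <= h.

Lemma horner_deriv_prod_XsubC (F : fieldType) (rs : seq F) (s : F) :
  s \notin rs ->
  (\prod_(z <- rs) ('X - z%:P))^`().[s] =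
  (\prod_(z <- rs) ('X - z%:P)).[s] * \sum_(z <- rs) (s - z)^-1.
Proof.
elim: rs => [|r rs IH]; first by rewrite !big_nil derivC horner0 mulr0.
rewrite inE negb_or => /andP[sr srs].
rewrite !big_cons derivM derivXsubC mul1r !hornerE IH //.
have s_r : s - r != 0 by rewrite subr_eq0.
by field.
Qed.

(* At a root of [f' + lam f] outside the roots of [f], [f' / f] (the sum of the
   [1 / (s - z)]) equals [- lam]; rotate by [u^-1] and compare real parts. *)
Lemma half_plane_deriv_addZ (C : numClosedFieldType) (u h lam : C) (f : {poly C}) :
  h \is Num.real -> lam != 0 -> 0 <= 'Re (lam / u) -> u != 0 -> f != 0 ->
  half_plane u h f -> half_plane u h (f^`() + lam *: f).
Proof.
move=> hR lam0 lamu u0 f0 fP s gs0.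
rewrite real_leNgt ?Creal_Re //; apply/negP => hs.
have [rs fE] := closed_field_poly_normal f.
have c0 : lead_coef f != 0 by rewrite lead_coef_eq0.
have rsP z : z \in rs -> 'Re (u * z) <= h.
  move=> zrs; apply: fP.
  by rewrite fE rootZ // root_prod_XsubC.
have srs : s \notin rs.
  apply/negP => /rsP; by rewrite real_leNgt ?Creal_Re // hs.
have /eqP : \sum_(z <- rs) (s - z)^-1 = - lam.
  move: gs0; rewrite /root fE derivZ scalerA !hornerE horner_deriv_prod_XsubC //.
  set q := (\prod_(z <- rs) _); set S := \sum_(z <- rs) _.
  rewrite (_ : _ + _ = lead_coef f * q.[s] * (S + lam)); last by ring.
  rewrite !mulf_eq0.
  rewrite (negPf c0) /= -/(root _ _) root_prod_XsubC (negPf srs) /=.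
  by rewrite addr_eq0 => /eqP.
(* This number is the inverse of [u * (s - z)], and inversion keeps the sign of the real part. *)
have pos z : z \in rs -> 0 < 'Re ((s - z)^-1 / u).
  move=> zrs; rewrite -invfM ReV divr_gt0 //.
    by rewrite mulrBl raddfB /= subr_gt0 ![_ * u]mulrC; apply: le_lt_trans (rsP z zrs) hs.
  rewrite exprn_gt0 // normr_gt0 mulf_neq0 // subr_eq0.
  by apply: contraNneq srs => ->.
case: rs {fE rsP srs} pos => [|z rs] pos.
  by rewrite big_nil eq_sym oppr_eq0 (negPf lam0).
move=> /eqP sE.
have : 'Re ((\sum_(z <- z :: rs) (s - z)^-1) / u) = - 'Re (lam / u).
  by rewrite sE mulNr raddfN.
rewrite mulr_suml raddf_sum /= big_cons => E.
have : 0 < - 'Re (lam / u).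
  rewrite -E ltr_wpDr ?pos ?mem_head // big_seq sumr_ge0 // => w wrs.
  by rewrite ltW // pos // inE wrs orbT.
by rewrite oppr_gt0 real_ltNge ?Creal_Re // lamu.
Qed.

Lemma size_deriv_addZ (F : fieldType) (lam : F) (f : {poly F}) :
  lam != 0 -> f != 0 -> size (f^`() + lam *: f) = size f.
Proof.
move=> lam0 f0; rewrite addrC size_polyDl size_scale //.
by rewrite lt_size_deriv.
Qed.

Lemma lead_coef_deriv_addZ (F : fieldType) (lam : F) (f : {poly F}) :
  lam != 0 -> f != 0 -> lead_coef (f^`() + lam *: f) = lam * lead_coef f.
Proof.
move=> lam0 f0; rewrite addrC lead_coefDl ?lead_coefZ // size_scale //.
by rewrite lt_size_deriv.
Qed.

(** * Laguerre polynomials and their roots *)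

(** This is [N! / (N + p)!] times the associated Laguerre polynomial [L_N^(p)] at [- lam X]. *)
Definition lagp (C : fieldType) (N p : nat) (lam : C) : {poly C} :=
  \poly_(r < N.+1) ('C(N, r)%:R * lam ^+ r / (p + r)`!%:R).

(** The binomial expansion of [(D + lam)^j], where [m - k] counts the derivatives. When [m - k > j]
    the exponent of [lam] is truncated, but the binomial coefficient is 0. The induction step is
    Pascal's rule. *)
Lemma iter_deriv_addZ_Xn (C : numFieldType) (lam : C) (j m : nat) :
  iter j (fun f : {poly C} => f^`() + lam *: f) 'X^m =
  \poly_(k < m.+1) ('C(j, m - k)%:R * lam ^+ (j - (m - k)) * m`!%:R / k`!%:R).
Proof.
have fact0 k : k`!%:R != 0 :> C by rewrite pnatr_eq0 -lt0n fact_gt0.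
elim: j => [|j IH].
  apply/polyP => k; rewrite coef_poly coefXn ltnS /=.
  have [->|km] := eqVneq k m.
    by rewrite leqnn subnn bin0 sub0n expr0 !mul1r divff.
  case: leqP => // km'; rewrite bin0n subn_eq0 leqNgt ltn_neqAle km km' /=.
  by rewrite !mul0r.
rewrite iterS IH; apply/polyP => k; rewrite coefD coef_deriv coefZ !coef_poly !ltnS.
case: (ltngtP k m) => [km|km|->]; first last.
- by rewrite mul0rn add0r subnn !bin0 !subn0 exprS; ring.
- by rewrite mul0rn mulr0 addr0.
have -> : (m - k = (m - k.+1).+1)%N by lia.
set d := (m - k.+1)%N; rewrite binS natrD subSS.
have kk : (k.+1)%:R != 0 :> C by rewrite pnatr_eq0.
rewrite factS natrM -mulr_natr; case: (ltnP d j) => dj.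
  have -> : (j - d = (j - d.+1).+1)%N by lia.
  by rewrite exprS; field; rewrite fact0 nat1r.
rewrite (@bin_small j d.+1) //; field.
by rewrite fact0 nat1r.
Qed.

(** A Rodrigues-type formula: at most [N] derivatives fall on ['X^(p + N)], so ['X^p] factors
    out. *)
Lemma iter_deriv_addZ_lagp (C : numFieldType) (lam : C) (N p : nat) :
  iter N (fun f : {poly C} => f^`() + lam *: f) 'X^(p + N) =
  (p + N)`!%:R *: (lagp N p lam * 'X^p).
Proof.
rewrite iter_deriv_addZ_Xn; apply/polyP => k.
rewrite coefZ coefMXn !coef_poly.
case: (ltnP k p) => kp.
  by rewrite mulr0 bin_small ?mul0r ?if_same //; lia.
have -> : (k < (p + N).+1)%N = (k - p < N.+1)%N by lia.
case: ltnP => kN; last by rewrite mulr0.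
have -> : (p + (k - p) = k)%N by lia.
have -> : (p + N - k = N - (k - p))%N by lia.
rewrite bin_sub; last by lia.
have -> : (N - (N - (k - p)) = k - p)%N by lia.
by ring.
Qed.

(** ['X^(p + N)] has only the root 0, and for [u = 'i] and [u = - 'i] the quotient [lam / u] has
    real part 0, so [D + lam] preserves both closed half-planes bounded by the real axis. Hence the
    roots are real, and positive coefficients exclude nonnegative ones. *)
Lemma lagp_root_lt0 (C : numClosedFieldType) (lam : C) (N p : nat) (z : C) :
  0 < lam -> root (lagp N p lam) z -> z < 0.
Proof.
move=> lam0 rz.
have E0 j : iter j (fun f : {poly C} => f^`() + lam *: f) 'X^(p + N) != 0.
  elim: j => [|j IH] /=; first by rewrite monic_neq0 ?monicXn.
  by rewrite -size_poly_eq0 size_deriv_addZ ?size_poly_eq0 ?gt_eqF.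
have hp (u : C) j : u != 0 -> 'Re (lam / u) = 0 ->
  half_plane u 0 (iter j (fun f : {poly C} => f^`() + lam *: f) 'X^(p + N)).
  move=> u0 lu; elim: j => [|j IH] /=.
    by move=> s /rootP; rewrite hornerXn => /eqP; rewrite expf_eq0 => /andP[_ /eqP->];
      rewrite mulr0 raddf0.
  by apply: (half_plane_deriv_addZ _ _ _ u0 (E0 j) IH); rewrite ?real0 ?lu ?lexx ?gt_eqF.
have rI : root (iter N (fun f : {poly C} => f^`() + lam *: f) 'X^(p + N)) z.
  by rewrite iter_deriv_addZ_lagp /root hornerZ hornerM (rootP rz) mul0r mulr0.
have lamR : lam \is Num.real by rewrite gtr0_real.
have zR : z \is Num.real.
  apply/Creal_ImP/eqP; rewrite eq_le.
  have h1 := hp 'i N (neq0Ci _) _ z rI; have h2 := hp (- 'i) N _ _ z rI.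
  move: h1; rewrite ReMil oppr_le0 => ->; last first.
    by rewrite invCi mulrN raddfN /= ReMl // Re_i mulr0 oppr0.
  rewrite andbT; move: h2; rewrite mulNr raddfN /= ReMil opprK; apply.
    by rewrite oppr_eq0 neq0Ci.
  by rewrite invrN invCi opprK ReMl // Re_i mulr0.
rewrite real_ltNge //; apply/negP => z0.
have : 0 < (lagp N p lam).[z].
  rewrite horner_poly big_ord_recl /= bin0 !expr0 mulr1 !mul1r.
  rewrite ltr_wpDr ?invr_gt0 ?ltr0n ?fact_gt0 //.
  by rewrite sumr_ge0 // => i _; rewrite !mulr_ge0 ?exprn_ge0 ?invr_ge0 ?ler0n ?(ltW lam0).
by rewrite (rootP rz) ltxx.
Qed.

(** * The operator [q(D^2)] and a lower bound at 0 *)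

Definition evalD2 (R : nzRingType) (q f : {poly R}) : {poly R} :=
  \sum_(i < size f) q`_i *: f^`(i.*2).

Lemma evalD2_mulXsubC (R : comNzRingType) (q f : {poly R}) (c : R) :
  evalD2 (('X - c%:P) * q) f = (evalD2 q f)^`()^`() - c *: evalD2 q f.
Proof.
have derivS (F : 'I_(size f) -> {poly R}) : (\sum_i F i)^`() = \sum_i (F i)^`().
  exact: raddf_sum.
rewrite /evalD2 scaler_sumr !derivS.
under eq_bigr => i _ do rewrite mulrBl coefB coefXM coefCM scalerBl.
rewrite sumrB; congr (_ - _); last first.
  by apply: eq_bigr => i _; rewrite scalerA.
under [RHS]eq_bigr => i _ do rewrite !derivZ -!derivnS -doubleS.
have [k sf ->] : exists2 k, (size f <= k)%N & size f = k by exists (size f).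
case: k sf => [|n] sf; first by rewrite !big_ord0.
rewrite big_ord_recl big_ord_recr /= scale0r add0r.
(* The index shift leaves one extra top term, of order [2n + 2], beyond the degree of [f]. *)
have -> : f^`(n.*2)^`()^`() = 0.
  by rewrite -!derivnS derivn_poly0 //; lia.
by rewrite scaler0 addr0.
Qed.

(** For [r < 0] and [k = sqrt(- r)], the factor [D^2 - r] splits as [(D + i k) (D - i k)]. Both
    shifts have real part 0, so each factor preserves the half-plane. *)
Lemma evalD2_half_plane (C : numClosedFieldType) (rs : seq C) (h : C) (f : {poly C}) :
  let g := evalD2 (\prod_(z <- rs) ('X - z%:P)) f in
  h \is Num.real -> f != 0 -> {in rs, forall z, z < 0} -> half_plane 1 h f ->
  [/\ size g = size f, lead_coef g = \prod_(z <- rs) (- z) * lead_coef f &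
      half_plane 1 h g].
Proof.
move=> g hR f0 + hf; rewrite {}/g; elim: rs => [|r rs IH] rsP.
  rewrite !big_nil mul1r; suff -> : evalD2 1 f = f by [].
  rewrite /evalD2; case sf : (size f) => [|n].
    by move/eqP: sf; rewrite size_poly_eq0 (negPf f0).
  rewrite big_ord_recl coef1 scale1r big1 ?addr0 // => i _.
  by rewrite coef1 scale0r.
have [|sg lg hg] := IH; first by move=> z zrs; apply: rsP; rewrite inE zrs orbT.
rewrite !big_cons evalD2_mulXsubC; set g := evalD2 _ f in sg lg hg *.
have r0 : 0 < - r by rewrite oppr_gt0 rsP ?mem_head.
pose k := sqrtC (- r); have k0 : 0 < k by rewrite sqrtC_gt0.
have kR : k \is Num.real by rewrite gtr0_real.
have g0 : g != 0 by rewrite -size_poly_eq0 sg size_poly_eq0.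
have ik0 : 'i * k != 0 by rewrite mulf_neq0 ?neq0Ci ?gt_eqF.
have nik0 : - ('i * k) != 0 by rewrite oppr_eq0.
have kk : 'i * k * ('i * k) = r by rewrite -expr2 exprMn sqrCi sqrtCK; ring.
pose g1 := g^`() + ('i * k) *: g.
have -> : g^`()^`() - r *: g = g1^`() + (- ('i * k)) *: g1.
  by rewrite /g1 derivD derivZ scaleNr scalerDr scalerA kk opprD addrA addrK.
have sg1 : size g1 = size g by rewrite size_deriv_addZ.
have g10 : g1 != 0 by rewrite -size_poly_eq0 sg1 size_poly_eq0.
split.
- by rewrite size_deriv_addZ // sg1.
- rewrite lead_coef_deriv_addZ // lead_coef_deriv_addZ // lg mulrA mulNr kk.
  by rewrite mulrA.
apply: half_plane_deriv_addZ; rewrite ?oner_eq0 //.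
  by rewrite divr1 raddfN /= ReMil (Creal_ImP _ kR) !oppr0.
apply: half_plane_deriv_addZ; rewrite ?oner_eq0 //.
by rewrite divr1 ReMil (Creal_ImP _ kR) oppr0.
Qed.

(** [|g(0)|] is the modulus of the leading coefficient times the product of the [|z|] over the
    roots, and [|z| >= - Re z >= e]. *)
Lemma norm_horner0_ge (C : numClosedFieldType) (e : C) (g : {poly C}) :
  0 <= e -> half_plane 1 (- e) g ->
  `|lead_coef g| * e ^+ (size g).-1 <= `|g.[0]|.
Proof.
move=> e0 hg; have [rs gE] := closed_field_poly_normal g.
have [->|g0] := eqVneq g 0; first by rewrite lead_coef0 normr0 mul0r.
have c0 : lead_coef g != 0 by rewrite lead_coef_eq0.
have sg : (size g).-1 = size rs by rewrite gE size_scale // size_prod_XsubC.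
rewrite sg {2}gE hornerZ normrM ler_wpM2l //.
have : {in rs, forall z, e <= `|z|}.
  move=> z zrs.
  have /hg : root g z by rewrite gE rootZ // root_prod_XsubC.
  rewrite mul1r => hz; apply: le_trans (_ : - 'Re z <= _); first by rewrite lerNr.
  by rewrite -raddfN /= -(normrN z); exact: (leif_Re_Creal (- z)).1.
elim: rs {gE sg} => [|r rs IH] rsP; first by rewrite expr0 big_nil hornerC normr1.
rewrite big_cons exprS hornerM normrM hornerXsubC sub0r normrN.
apply: ler_pM; rewrite ?exprn_ge0 ?rsP ?mem_head //.
by apply: IH => z zrs; rewrite rsP // inE zrs orbT.
Qed.

(** * Explicit rate of convergence to the Bessel-type series *)

Lemma ffact_leq_expn (N r : nat) : (N ^_ r <= N ^ r)%N.
Proof.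
elim: r => [|r IH]; first by rewrite ffactn0.
by rewrite ffactnSr expnSr leq_mul // leq_subr.
Qed.

(** A division-free form of [1 - N^_r / N^r <= r^2 / N]; passing from [r] to [r + 1] costs at most
    another [r / N]. *)
Lemma expn_leq_ffactD (N r : nat) : (N * N ^ r <= N * N ^_ r + r * r * N ^ r)%N.
Proof.
elim: r => [|r IH]; first by rewrite ffactn0 expn0 muln1 leq_addr.
rewrite ffactnSr expnSr.
have le1 := ffact_leq_expn N r.
move: (N ^ r)%N (N ^_ r)%N IH le1 => a b IH le1.
have h : (N * a * N <= (N * b + r * r * a) * N)%N by rewrite leq_mul2r IH orbT.
have h2 : (N * b * N <= N * b * (N - r) + N * b * r)%N.
  by rewrite -mulnDr leq_mul //; lia.
have h3 : (N * b * r <= N * a * r)%N by rewrite leq_mul // leq_mul.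
nia.
Qed.

Lemma dist_bin_expn (C : numFieldType) (N r : nat) : (0 < N)%N ->
  `|'C(N, r)%:R * N%:R^-1 ^+ r - r`!%:R^-1| <= (r * r)%:R / N%:R :> C.
Proof.
move=> N0; have N0' : 0 < N%:R :> C by rewrite ltr0n.
have r0 : 0 < r`!%:R :> C by rewrite ltr0n fact_gt0.
have le1 := ffact_leq_expn N r.
have Nr0 : 0 < N%:R ^+ r :> C by rewrite exprn_gt0.
have -> : 'C(N, r)%:R * N%:R^-1 ^+ r - r`!%:R^-1 =
    - ((N ^ r - N ^_ r)%:R / (N%:R ^+ r * r`!%:R)) :> C.
  rewrite natrB // -bin_ffact natrM natrX exprVn.
  by field; rewrite !gt_eqF.
rewrite normrN ger0_norm ?divr_ge0 ?ler0n ?mulr_ge0 ?(ltW Nr0) //.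
rewrite invfM mulrA.
apply: le_trans (_ : (N ^ r - N ^_ r)%:R / N%:R ^+ r <= _).
  rewrite ler_piMr ?divr_ge0 ?ler0n ?(ltW Nr0) //.
  by rewrite invf_le1 // ler1n fact_gt0.
rewrite ler_pdivrMr // mulrAC ler_pdivlMr // -natrX -!natrM ler_nat.
by have := expn_leq_ffactD N r; nia.
Qed.

Lemma evalD2Z (R : comNzRingType) (c : R) (q f : {poly R}) :
  evalD2 (c *: q) f = c *: evalD2 q f.
Proof.
rewrite /evalD2 scaler_sumr; apply: eq_bigr => i _.
by rewrite coefZ scalerA.
Qed.

(** The leading coefficient of [q(D^2) f] is that of [f] times [q.[0]], which is [1 / p!] whatever
    [N] and [lam] are. *)
Lemma evalD2_lagp_ge (C : numClosedFieldType) (N p : nat) (lam e : C) (f : {poly C}) :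
  0 < lam -> 0 < e -> f != 0 -> half_plane 1 (- e) f ->
  `|lead_coef f| / p`!%:R * e ^+ (size f).-1 <= `|(evalD2 (lagp N p lam) f).[0]|.
Proof.
move=> lam0 e0 f0 hf; set q := lagp N p lam.
have [rs qE] := closed_field_poly_normal q.
have q0 : q.[0] = p`!%:R^-1.
  by rewrite horner_coef0 coef_poly bin0 expr0 addn0 mulr1 mul1r.
have c0 : lead_coef q != 0.
  rewrite lead_coef_eq0; apply/eqP => qq.
  by move/eqP: q0; rewrite qq horner0 eq_sym invr_eq0 pnatr_eq0 -leqn0 leqNgt fact_gt0.
have rsP : {in rs, forall z, z < 0}.
  move=> z zrs; apply: (@lagp_root_lt0 _ lam N p) => //.
  by rewrite -/q qE rootZ // root_prod_XsubC.
have eR : - e \is Num.real by rewrite rpredN gtr0_real.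
have [sg lg hg] := evalD2_half_plane eR f0 rsP hf.
rewrite qE evalD2Z hornerZ normrM.
apply: le_trans (ler_wpM2l (normr_ge0 _) (norm_horner0_ge (ltW e0) hg)).
rewrite sg lg mulrA ler_wpM2r ?exprn_ge0 ?(ltW e0) //.
rewrite -normrM mulrA normrM mulrC.
suff -> : lead_coef q * \prod_(z <- rs) - z = p`!%:R^-1.
  by rewrite normfV normr_nat.
rewrite -q0 [in RHS]qE hornerZ horner_prod; congr (_ * _).
by apply: eq_bigr => z _; rewrite hornerXsubC sub0r.
Qed.

(* As [N] grows, [lagp N p N^-1] tends coefficientwise to the Bessel-type series
   [\sum_r u^r / (r! (p + r)!)], and the lower bound [evalD2_lagp_ge] does not
   depend on [lam = N^-1]. *)
Lemma bessel_derivn_neq0 (C : numClosedFieldType) (p : nat) (e : C) (f : {poly C}) :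
  Num.archimedean_axiom C ->
  0 < e -> f != 0 -> half_plane 1 (- e) f ->
  \sum_(r < size f) f^`(r.*2).[0] / (r`!%:R * (p + r)`!%:R) != 0.
Proof.
move=> archi e0 f0 hf; apply/eqP => S0.
pose d := `|lead_coef f| / p`!%:R * e ^+ (size f).-1.
have d0 : 0 < d.
  rewrite mulr_gt0 ?exprn_gt0 // divr_gt0 ?ltr0n ?fact_gt0 //.
  by rewrite normr_gt0 lead_coef_eq0.
pose M := \sum_(r < size f) (r * r)%:R * (`|f^`(r.*2).[0]| / (p + r)`!%:R).
have M0 : 0 <= M.
  by rewrite sumr_ge0 // => i _; rewrite mulr_ge0 ?ler0n ?divr_ge0.
(* Subtracting the sum assumed to be 0 turns the value at 0 into a combination of the errors of
   [dist_bin_expn], hence at most [M / N], while it is at least [d]. *)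
have main N : (0 < N)%N -> d * N%:R <= M.
  move=> N0; have N0' : 0 < N%:R :> C by rewrite ltr0n.
  have := evalD2_lagp_ge N p (_ : 0 < N%:R^-1) e0 f0 hf.
  rewrite invr_gt0 -/d => /(_ N0') h; rewrite -ler_pdivlMr //.
  apply: le_trans h _; rewrite -[X in `|X|]subr0 -[X in _ - X]S0.
  rewrite horner_sum -sumrB /M mulr_suml.
  apply: le_trans (ler_norm_sum _ _ _) _; apply: ler_sum => r _.
  rewrite hornerZ coef_poly.
  have -> : (if (r < N.+1)%N then 'C(N, r)%:R * N%:R^-1 ^+ r / (p + r)`!%:R else 0)
     = 'C(N, r)%:R * N%:R^-1 ^+ r / (p + r)`!%:R :> C.
    by case: ltnP => // Nr; rewrite bin_small // !mul0r.
  rewrite invfM (_ : _ - _ = ('C(N, r)%:R * N%:R^-1 ^+ r - r`!%:R^-1) *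
     (f^`(r.*2).[0] / (p + r)`!%:R)); last by ring.
  rewrite normrM [leRHS]mulrAC; apply: ler_pM => //; first exact: dist_bin_expn.
  by rewrite normf_div normr_nat.
have [N hN] := archi (M / d).
rewrite ger0_norm ?divr_ge0 ?(ltW d0) // in hN.
have N0 : (0 < N)%N.
  rewrite -(ltr0n C); apply: le_lt_trans hN; by rewrite divr_ge0 // ltW.
move: hN; rewrite ltr_pdivrMr // mulrC => hN.
by have := lt_le_trans hN (main N N0); rewrite ltxx.
Qed.

(** * Homogenization and products of linear factors *)

(** This is [u^n q(v / u)] without denominators, [q] being read as a form of degree [n]; it replaces
    Laurent polynomials by polynomials. *)
Definition homog (R : comNzRingType) (n : nat) (q u v : {poly R}) : {poly R} :=
  \sum_(m < n.+1) q`_m *: (v ^+ m * u ^+ (n - m)).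

Lemma homog_mul (R : comNzRingType) (n : nat) (a b : R) (q u v : {poly R}) :
  (size q <= n.+1)%N ->
  homog n.+1 ((a%:P + b *: 'X) * q) u v = (a *: u + b *: v) * homog n q u v.
Proof.
move=> sq; rewrite /homog mulrDl.
under eq_bigr => m _ do rewrite coefD coefCM -scalerAl coefZ coefXM scalerDl.
rewrite big_split /= [in RHS]mulrDl; congr (_ + _).
  rewrite big_ord_recr /= (nth_default _ sq) mulr0 scale0r addr0 mulr_sumr.
  apply: eq_bigr => m _.
  rewrite -scalerAl -scalerAr scalerA mulrCA -exprS -subSn //.
  by rewrite -ltnS.
rewrite big_ord_recl /= mulr0 scale0r add0r mulr_sumr.
by apply: eq_bigr => m _; rewrite -scalerAl -scalerAr scalerA mulrA -exprS.
Qed.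

Lemma size_prod_linear (R : comNzRingType) (n : nat) (a b : 'I_n -> R) :
  (size (\prod_(i < n) ((a i)%:P + b i *: 'X))%R <= n.+1)%N.
Proof.
elim: n a b => [|n IH] a b; first by rewrite big_ord0 size_poly1.
rewrite big_ord_recl; apply: leq_trans (size_polyMleq _ _) _.
have := IH (fun i => a (lift ord0 i)) (fun i => b (lift ord0 i)).
have : (size ((a ord0)%:P + b ord0 *: 'X)%R <= 2)%N.
  rewrite (leq_trans (size_polyD _ _)) // geq_max (leq_trans (size_polyC_leq1 _)) //=.
  by rewrite (leq_trans (size_scale_leq _ _)) ?size_polyX.
by move: (size _) (size _) => s t; lia.
Qed.

Lemma homog_prod (R : comNzRingType) (n : nat) (a b : 'I_n -> R) (u v : {poly R}) :
  homog n (\prod_(i < n) ((a i)%:P + b i *: 'X)) u v =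
  \prod_(i < n) (a i *: u + b i *: v).
Proof.
elim: n a b => [|n IH] a b.
  by rewrite /homog !big_ord0 big_ord_recl big_ord0 coef1 !expr0 mulr1 scale1r addr0.
by rewrite !big_ord_recl homog_mul ?IH // size_prod_linear.
Qed.

(** * Von Szily's identity and middle coefficients *)

(** The middle coefficient is von Szily's alternating sum up to sign. Induction on [p] uses
    [(1 - X)^2 = (1 + X)^2 - 4 X], which reduces [(r, p + 1)] to [(r + 1, p)] and [(r, p)]. *)
Lemma szily (F : numFieldType) (r p : nat) :
  ((1 + 'X : {poly F}) ^+ (2 * r) * (1 - 'X) ^+ (2 * p))`_(r + p) =
  (-1) ^+ p * (2 * p)`!%:R * (2 * r)`!%:R / (p`!%:R * r`!%:R * (p + r)`!%:R).
Proof.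
have factN0 k : k`!%:R != 0 :> F by rewrite pnatr_eq0 -lt0n fact_gt0.
elim: p r => [|p IH] r.
  rewrite muln0 !expr0 !mulr1 addn0 add0n [1 + _]addrC exprD1n coef_sum.
  rewrite (eq_bigr (fun i : 'I_(2 * r).+1 => (if i == r :> nat then 'C(2 * r, i)%:R else 0))).
    have rr : (r < (2 * r).+1)%N by lia.
    rewrite -big_mkcond (big_pred1 (Ordinal rr)) //=.
    have := @bin_fact (2 * r) r; rewrite (_ : (2 * r - r = r)%N); last by lia.
    move=> <-; last by lia.
    by rewrite fact0 !natrM; field; rewrite factN0.
  by move=> i _; rewrite coefMn coefXn eq_sym; case: eqP => [->|_]; rewrite ?mul0rn.
have -> : (1 + 'X : {poly F}) ^+ (2 * r) * (1 - 'X) ^+ (2 * p.+1) =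
   (1 + 'X) ^+ (2 * r.+1) * (1 - 'X) ^+ (2 * p) -
   4%:R *: ((1 + 'X) ^+ (2 * r) * (1 - 'X) ^+ (2 * p) * 'X).
  rewrite !mulnS !exprD -mul_polyC rmorph_nat; ring.
rewrite coefB coefZ coefMX addnS /= -addSn IH addSn /= IH.
rewrite !mulnS !addSn !add0n !factS exprS addnS factS !natrM.
by field; rewrite !factN0 -natrD !nat1r !pnatr_eq0.
Qed.

(** This is the constant term of [(w + 1/w)^m (w - 1/w)^(2p)]. Everything is a polynomial in [X^2],
    so odd [m] gives 0 and even [m] reduces to [szily]. *)
Lemma coef_one_add_Xsqr_exp (F : numFieldType) (m p : nat) :
  ((1 + 'X^2 : {poly F}) ^+ m * (1 - 'X^2) ^+ (2 * p))`_(2 * p + m) =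
  if odd m then 0 else
  (-1) ^+ p * (2 * p)`!%:R * m`!%:R / (p`!%:R * m./2`!%:R * (p + m./2)`!%:R).
Proof.
have -> : (1 + 'X^2 : {poly F}) ^+ m * (1 - 'X^2) ^+ (2 * p) =
   ((1 + 'X) ^+ m * (1 - 'X) ^+ (2 * p)) \Po 'X^2.
  by rewrite rmorphM !rmorphXn rmorphB rmorphD /= comp_polyX rmorph1.
rewrite coef_comp_poly_Xn // dvdn2 oddD oddM /=.
case: (boolP (odd m)) => om //=.
have mE : m = (2 * m./2)%N by rewrite mul2n even_halfK.
have -> : ((2 * p + m) %/ 2 = m./2 + p)%N by rewrite {1}mE -mulnDr mulKn // addnC.
by rewrite {1 3}mE szily.
Qed.

Lemma coef_homog (F : numFieldType) (n p : nat) (f : {poly F}) : (size f <= n.+1)%N ->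
  (homog n f 'X (1 + 'X^2) * (1 - 'X^2) ^+ (2 * p))`_(2 * p + n) =
  (-1) ^+ p * (2 * p)`!%:R / p`!%:R *
  \sum_(r < size f) f^`(r.*2).[0] / (r`!%:R * (p + r)`!%:R).
Proof.
move=> sf; rewrite /homog mulr_suml coef_sum.
pose G m : F := if odd m then 0 else
  f`_m * m`!%:R / (m./2`!%:R * (p + m./2)`!%:R).
transitivity ((-1) ^+ p * (2 * p)`!%:R / p`!%:R * \sum_(0 <= m < n.+1) G m).
  rewrite big_mkord mulr_sumr; apply: eq_bigr => m _.
  rewrite -scalerAl coefZ [_ * 'X^_ * _]mulrAC coefMXn.
  have mn : (m <= n)%N by rewrite -ltnS.
  rewrite ifF; last by apply/negbTE; rewrite -leqNgt; lia.
  have -> : (2 * p + n - (n - m) = 2 * p + m)%N by lia.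
  rewrite coef_one_add_Xsqr_exp /G; case: ifP => _; first by rewrite !mulr0.
  by rewrite !invfM; ring.
congr (_ * _).
(* Zero terms are appended so that the indices pair up as even and odd. *)
transitivity (\sum_(0 <= m < (n.+1).*2) G m).
  rewrite [RHS](big_cat_nat (n := n.+1)) //=; last by lia.
  rewrite [X in _ = _ + X]big_nat [X in _ = _ + X]big1 ?addr0 // => m /andP[mn _].
  by rewrite /G (nth_default _ (leq_trans sf mn)) !mul0r if_same.
transitivity (\sum_(0 <= r < n.+1) G r.*2).
  elim: n.+1 => [|k IH]; first by rewrite !big_geq.
  rewrite doubleS !big_nat_recr //= IH /G /= odd_double /= addr0.
  by [].
rewrite (big_cat_nat (n := size f)) //= [X in _ + X]big_nat [X in _ + X]big1 ?addr0; last first.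
  move=> r /andP[sr _].
  by rewrite /G odd_double nth_default ?mul0r // -addnn (leq_trans sr) ?leq_addr.
rewrite big_mkord; apply: eq_bigr => r _.
rewrite /G odd_double /= doubleK horner_coef0 coef_derivn addn0 ffactnn.
by rewrite mulr_natr.
Qed.

(** * Diagonal sums and their relation to [Lcoef] *)

(** For [q] of degree at most [n], the coefficient of [w^j], and by symmetry of [w^(-j)], in
    [q(x w) q(x / w)]. *)
Definition diag_sum (R : comNzRingType) (n : nat) (q : {poly R}) (x : R) (j : nat) : R :=
  \sum_(k < n.+1) \sum_(l < n.+1 | (k + j == l)%N) q`_k * q`_l * x ^+ (k + l).

Lemma sum_coefz_diag (R : comNzRingType) (n : nat) (q : {poly R}) (x : R) (j : nat) :
  (size q <= n.+1)%N ->
  \sum_(0 <= k < n.+1) coefz q (k%:Z - j%:Z) * coefz q (k%:Z + j%:Z) * (x ^+ 2) ^+ k =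
  diag_sum n q x (2 * j).
Proof.
move=> sq.
have coefzB (a b : nat) : coefz q (a%:Z - b%:Z) = if (b <= a)%N then q`_(a - b) else 0.
  case: leqP => ab; first by rewrite subzn.
  have -> : a%:Z - b%:Z = Negz (b - a).-1 by rewrite NegzE prednK ?subn_gt0 // -subzn ?opprB // ltnW.
  by [].
transitivity (\sum_(0 <= k < n.+1) q`_k * q`_(k + 2 * j) * x ^+ (k + (k + 2 * j))).
  pose G k := coefz q (k%:Z - j%:Z) * coefz q (k%:Z + j%:Z) * (x ^+ 2) ^+ k.
  (* Extending the range by [j] zero terms prepares the shift of [k] by [j]; the terms with [k < j]
     vanish because their index [k - j] is negative. *)
  transitivity (\sum_(0 <= k < n.+1 + j) G k).
    rewrite [RHS](big_cat_nat (n := n.+1)) //=; last by lia.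
    rewrite [X in _ = _ + X]big_nat [X in _ = _ + X]big1 ?addr0 // => k /andP[kn _].
    rewrite /G -PoszD /= [q`_(k + j)]nth_default ?mulr0 ?mul0r //.
    by apply: leq_trans sq _; lia.
  rewrite (big_cat_nat (n := j)) //=; last by lia.
  rewrite [X in X + _]big_nat [X in X + _]big1 ?add0r; last first.
    move=> k /andP[_ kj].
    by rewrite /G coefzB leqNgt kj !mul0r.
  rewrite -{1}[j]add0n big_addn addnK; apply: eq_bigr => k _.
  rewrite /G coefzB leq_addl addnK -PoszD /= -exprM.
  by rewrite (_ : k + j + j = k + 2 * j)%N 1?(_ : 2 * (k + j) = k + (k + 2 * j))%N //; lia.
rewrite big_mkord /diag_sum; apply: eq_bigr => k _.
case: (ltnP (k + 2 * j) n.+1) => kj.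
  by rewrite (big_pred1 (Ordinal kj)) //= => l; rewrite eq_sym.
rewrite [q`_(k + _)]nth_default ?mulr0 ?mul0r; last exact: leq_trans sq kj.
by rewrite big1 // => l /eqP E; move: (ltn_ord l); rewrite -E ltnNge kj.
Qed.

Lemma sum_nat_center (V : nmodType) (p : nat) (G : nat -> V) :
  \sum_(0 <= i < (2 * p).+1) G i =
  G p + \sum_(1 <= j < p.+1) (G (p - j)%N + G (p + j)%N).
Proof.
rewrite (big_cat_nat (n := p)) //=; last by lia.
rewrite [X in _ + X]big_ltn; last by lia.
rewrite big_split /= addrCA; congr (_ + (_ + _)).
  rewrite big_nat_rev /= big_add1 /=; apply: eq_bigr => i _.
  by rewrite add0n.
rewrite -[X in \sum_(X <= _ < _) _]add1n big_addn.
have -> : ((2 * p).+1 - p = p.+1)%N by lia.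
by apply: eq_bigr => i _; rewrite addnC.
Qed.

(** Expand [(1 - X^2)^(2p)]: its [i]-th term selects the pairs with [l - k = 2 (i - p)]. Exchanging
    [k] and [l] identifies [i = p - j] with [i = p + j], whence the factor 2. *)
Lemma coef_homog2 (R : comNzRingType) (n p : nat) (q : {poly R}) (x : R) :
  (homog n q 1 (x *: 'X) * homog n q 'X x%:P * (1 - 'X^2) ^+ (2 * p))`_(2 * p + n) =
  (-1) ^+ p * ('C(2 * p, p)%:R * diag_sum n q x 0 +
    2%:R * \sum_(1 <= j < p.+1) (-1) ^+ j * 'C(2 * p, p - j)%:R * diag_sum n q x (2 * j)).
Proof.
pose B i := \sum_(k < n.+1) \sum_(l < n.+1 | (k + 2 * i == 2 * p + l)%N) q`_k * q`_l * x ^+ (k + l).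
transitivity (\sum_(0 <= i < (2 * p).+1) (-1) ^+ i * 'C(2 * p, i)%:R * B i).
  have -> : (1 - 'X^2) ^+ (2 * p) =
    \sum_(i < (2 * p).+1) ((-1) ^+ i * 'C(2 * p, i)%:R) *: 'X^(2 * i) :> {poly R}.
    rewrite addrC exprD1n; apply: eq_bigr => i _.
    rewrite (exprNn 'X^2) -exprM -mulr_natr mulrC -mul_polyC rmorphM rmorphXn rmorphN1 rmorph_nat /=.
    by ring.
  rewrite big_mkord mulr_sumr coef_sum; apply: eq_bigr => i _.
  rewrite -scalerAr coefZ; congr (_ * _).
  rewrite /homog mulr_suml mulr_suml coef_sum; apply: eq_bigr => k _.
  rewrite mulr_sumr mulr_suml coef_sum [RHS]big_mkcond; apply: eq_bigr => l _.
  have -> : q`_k *: ((x *: 'X) ^+ k * 1 ^+ (n - k)) * (q`_l *: (x%:P ^+ l * 'X^(n - l)))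
     * 'X^(2 * i) = (q`_k * q`_l * x ^+ (k + l)) *: 'X^(k + (n - l) + 2 * i).
    rewrite expr1n mulr1 exprZn -rmorphXn /= mul_polyC !scalerA -scalerAl -scalerAr.
    rewrite scalerA -scalerAl !exprD; congr (_ *: _); ring.
  rewrite coefZ coefXn; have ln : (l <= n)%N by rewrite -ltnS.
  have -> : (2 * p + n == k + (n - l) + 2 * i)%N = (k + 2 * i == 2 * p + l)%N.
    by apply/eqP/eqP; lia.
  by case: eqP => _; rewrite ?mulr1 ?mulr0.
have Bp j : B (p + j)%N = diag_sum n q x (2 * j).
  apply: eq_bigr => k _; apply: eq_bigl => l; apply/eqP/eqP; lia.
have Bm j : (j <= p)%N -> B (p - j)%N = diag_sum n q x (2 * j).
  move=> jp; rewrite /B /diag_sum.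
  under eq_bigr => k _ do rewrite big_mkcond.
  rewrite exchange_big /=; apply: eq_bigr => k _.
  rewrite [RHS]big_mkcond; apply: eq_bigr => l _.
  have -> : (l + 2 * (p - j) == 2 * p + k)%N = (k + 2 * j == l)%N by apply/eqP/eqP; lia.
  by rewrite [q`_k * _]mulrC [(k + l)%N]addnC.
rewrite sum_nat_center -{4}[p]addn0 Bp muln0 mulrDr; congr (_ + _).
  by rewrite mulrA.
rewrite !mulr_sumr big_nat [RHS]big_nat; apply: eq_bigr => j /andP[j1 jp].
rewrite Bp Bm //.
have -> : 'C(2 * p, p + j) = 'C(2 * p, p - j).
  by rewrite -bin_sub; [congr 'C(_, _)|]; lia.
have -> : (-1) ^+ (p - j) = (-1) ^+ (p + j) :> R.
  by rewrite -signr_odd -[in RHS]signr_odd; congr (_ ^+ (nat_of_bool _)); lia.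
by rewrite exprD; ring.
Qed.

Lemma sum_Lcoef_diag (F : numFieldType) (n p : nat) (q : {poly F}) (x : F) :
  (0 < p)%N -> (size q <= n.+1)%N ->
  2%:R * \sum_(0 <= k < n.+1) Lcoef p q k * (x ^+ 2) ^+ k =
  'C(2 * p, p)%:R * diag_sum n q x 0 +
    2%:R * \sum_(1 <= j < p.+1) (-1) ^+ j * 'C(2 * p, p - j)%:R * diag_sum n q x (2 * j).
Proof.
move=> p0 sq.
(* Pascal's rule and symmetry; [0 < p] keeps [2 * p - 1] from being truncated. *)
have -> : 'C(2 * p, p)%:R = 2%:R * 'C(2 * p - 1, p)%:R :> F.
  case: p p0 => // p _; rewrite -natrM; congr (_%:R).
  have -> : (2 * p.+1 = (2 * p).+2)%N by lia.
  rewrite subn1 /= binS; have -> : ('C((2 * p).+1, p) = 'C((2 * p).+1, p.+1))%N.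
    by rewrite -bin_sub; [congr 'C(_, _)|]; lia.
  by lia.
rewrite -mulrA -mulrDr; congr (_ * _).
have d0 := sum_coefz_diag x 0 sq; rewrite muln0 in d0; rewrite -d0.
under [X in _ = _ + X]eq_bigr => j _ do rewrite -sum_coefz_diag // mulr_sumr.
rewrite exchange_big /= mulr_sumr -big_split; apply: eq_bigr => k _ /=.
rewrite addn0 /Lcoef /= mulrDl; congr (_ + _); first by ring.
by rewrite mulr_suml; apply: eq_bigr => j _; ring.
Qed.

(* With [f] as below, [w^n f(w + 1/w) = psi(x w) * w^n psi(x / w)]; both sides
   are paired with the Laurent coefficients of [(1 - w^2)^(2p)]. *)
Lemma sum_Lcoef_bessel (F : numFieldType) (n p : nat) (b : 'I_n -> F) (x : F) :
  let f := \prod_(i < n) ((1 + (b i * x) ^+ 2)%:P + (b i * x) *: 'X) in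
  (0 < p)%N ->
  \sum_(0 <= k < n.+1) Lcoef p (\prod_(i < n) (1 + b i *: 'X)) k * (x ^+ 2) ^+ k =
  (2 * p)`!%:R / (2%:R * p`!%:R) *
  \sum_(r < size f) f^`(r.*2).[0] / (r`!%:R * (p + r)`!%:R).
Proof.
move=> f p0; set q := \prod_(i < n) (1 + b i *: 'X).
have qE : q = \prod_(i < n) ((1 : F)%:P + b i *: 'X) by [].
have sq : (size q <= n.+1)%N by rewrite qE size_prod_linear.
have sf : (size f <= n.+1)%N by rewrite size_prod_linear.
(* Factor by factor, with [c = b i * x]: [(1 + c^2) X + c (1 + X^2) = (1 + c X) (X + c)]. *)
have E : homog n f 'X (1 + 'X^2) = homog n q 1 (x *: 'X) * homog n q 'X x%:P.
  rewrite qE !homog_prod -big_split; apply: eq_bigr => i _ /=.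
  by rewrite -!mul_polyC !(rmorphD, rmorphM, rmorphXn, rmorph1) /=; ring.
have := coef_homog p sf; rewrite E coef_homog2 -sum_Lcoef_diag //.
set S := \sum_(0 <= k < _) _; set T := \sum_(r < _) _ => H.
have p1 : (-1) ^+ p != 0 :> F by rewrite expf_neq0 // oppr_eq0 oner_eq0.
have p2 : p`!%:R != 0 :> F by rewrite pnatr_eq0 -lt0n fact_gt0.
apply: (mulfI (_ : (-1) ^+ p * 2%:R != 0)); first by rewrite mulf_neq0 // pnatr_eq0.
transitivity ((-1) ^+ p * (2%:R * S)); first by ring.
by rewrite H; field.
Qed.

(** * Nonvanishing at squares of numbers with positive real part *)

(** There are finitely many roots, so [e] can be the least [- 'Re z], capped by 1. *)
Lemma half_plane_lt0 (C : numClosedFieldType) (f : {poly C}) : f != 0 ->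
  (forall z, root f z -> 'Re z < 0) -> exists2 e : C, 0 < e & half_plane 1 (- e) f.
Proof.
move=> f0 hf; have [rs fE] := closed_field_poly_normal f.
have rsP z : root f z = (z \in rs).
  by rewrite fE rootZ ?lead_coef_eq0 // root_prod_XsubC.
have {hf} : forall z, z \in rs -> 'Re z < 0 by move=> z; rewrite -rsP; apply: hf.
suff H : (forall z, z \in rs -> 'Re z < 0) ->
    exists2 e : C, 0 < e & {in rs, forall z, 'Re z <= - e}.
  by move/H => [e e0 he]; exists e => // z; rewrite rsP mul1r; apply: he.
elim: rs {fE rsP} => [|r rs IH] hrs; first by exists 1.
have [z zrs|e e0 he] := IH; first by rewrite hrs // inE zrs orbT.
have r0 : 0 < - 'Re r by rewrite oppr_gt0 hrs ?mem_head.
have : - 'Re r \is Num.real by rewrite rpredN Creal_Re.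
move=> /real_leP /(_ (gtr0_real e0)) [re|er].
  exists (- 'Re r) => // z; rewrite inE opprK => /predU1P[->//|/he].
  by move/le_trans; apply; rewrite lerNl.
exists e => // z; rewrite inE => /predU1P[->|/he//].
by rewrite lerNr ltW.
Qed.

Lemma sum_Lcoef_neq0 (C : numClosedFieldType) (n p : nat) (b : 'I_n -> C) (x : C) :
  Num.archimedean_axiom C -> (0 < p)%N -> (forall i, 0 < b i) -> 0 < 'Re x ->
  \sum_(0 <= k < n.+1) Lcoef p (\prod_(i < n) (1 + b i *: 'X)) k * (x ^+ 2) ^+ k != 0.
Proof.
move=> archi p0 b0 x0; rewrite sum_Lcoef_bessel //; set f := \prod_(i < n) _.
have fact0 k : k`!%:R != 0 :> C by rewrite pnatr_eq0 -lt0n fact_gt0.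
have xn0 : x != 0 by apply: contraTneq x0 => ->; rewrite raddf0 ltxx.
have bx i : b i * x != 0 by rewrite mulf_neq0 // gt_eqF.
have f0 : f != 0.
  rewrite prodf_seq_neq0; apply/allP => i _ /=; apply/eqP => /(congr1 (coefp 1)).
  by rewrite /coefp /= coefD coefC coefZ coefX coef0 add0r mulr1; apply/eqP.
have rf z : root f z -> 'Re z < 0.
  rewrite /root horner_prod prodf_seq_eq0 => /hasP[i _ /=].
  rewrite !hornerE => /eqP E.
  have -> : z = - ((b i * x)^-1 + b i * x).
    apply: (mulfI (bx i)); rewrite mulrN mulrDr divff // -expr2.
    by apply/eqP; rewrite -addr_eq0 addrC E.
  have bR : b i \is Num.real by rewrite gtr0_real.
  rewrite raddfN raddfD /= oppr_lt0 ReV ReMl // addr_gt0 ?divr_gt0 ?mulr_gt0 //;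
    by rewrite normr_gt0.
have [e e0 he] := half_plane_lt0 f0 rf.
rewrite mulf_neq0 ?(bessel_derivn_neq0 _ archi e0) //.
by rewrite mulf_neq0 ?invr_eq0 ?mulf_neq0 ?pnatr_eq0 // -?lt0n ?fact_gt0.
Qed.

(** * Passage to [R[i]] and conclusion *)

Lemma archimedean_complex (R : realType) : Num.archimedean_axiom (complex R).
Proof.
move=> z; exists (Num.bound (complex.Re `|z|)).
have zE : (complex.Re `|z|)%:C%C = `|z| by rewrite RRe_real ?normr_real.
have z0 : 0 <= complex.Re `|z| by rewrite -lecR zE normr_ge0.
by rewrite -[ltLHS]zE -(rmorph_nat (real_complex R)) ltcR archi_boundP.
Qed.

Lemma coefz_map (R S : nzRingType) (h : {rmorphism R -> S}) (q : {poly R}) (k : int) :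
  coefz (map_poly h q) k = h (coefz q k).
Proof. by case: k => m /=; rewrite ?coef_map ?rmorph0. Qed.

Lemma Lcoef_map (R S : nzRingType) (h : {rmorphism R -> S}) (p : nat) (q : {poly R}) (k : nat) :
  Lcoef p (map_poly h q) k = h (Lcoef p q k).
Proof.
rewrite /Lcoef rmorphD rmorphM rmorphXn rmorph_nat coefz_map rmorph_sum /=.
congr (_ + _); apply: eq_bigr => j _.
by rewrite !coefz_map !rmorphM rmorphXn rmorphN1 rmorph_nat coef_map.
Qed.

Theorem theorem18 (R : realType) (n : nat) (rho : 'I_n -> R)
    (rho_gt0 : forall k : 'I_n, 0 < rho k)
    (psi : {poly R}) (psiE : psi = \prod_(k < n) (1 + rho k *: 'X))
    (p : nat) (p_gt0 : (0 < p)%N) (z : R[i])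
    (z_zero : root (map_poly (real_complex R)
                     (\sum_(0 <= k < n.+1) Lcoef p psi k *: 'X^k)) z) :
  exists2 x : R, x < 0 & z = (x%:C)%C.
Proof.
(* Since [x] and [- x] have the same square, ['Re x] may be taken positive. *)
have nz (x : R[i]) : 'Re x != 0 -> x ^+ 2 != z.
  wlog x0 : x / 0 < 'Re x.
    move=> H xn0; have := xn0; rewrite real_neqr_lt ?Creal_Re // => /orP[xl|xg].
      by rewrite -sqrrN H // raddfN ?oppr_gt0 ?oppr_eq0.
    exact: H.
  move=> _; apply/eqP => xz; move: z_zero.
  have psiC : map_poly (real_complex R) psi =
      \prod_(k < n) (1 + (rho k)%:C%C *: 'X).
    rewrite psiE rmorph_prod; apply: eq_bigr => k _.
    by rewrite rmorphD rmorph1 /= map_polyZ map_polyX.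
  rewrite /root rmorph_sum horner_sum -xz.
  under eq_bigr => k _ do rewrite /= map_polyZ map_polyXn hornerZ hornerXn -Lcoef_map psiC.
  apply/negP; apply: sum_Lcoef_neq0 => //; first exact: archimedean_complex.
  by move=> i; rewrite ltcR.
(* The constant coefficient is ['C(2 * p - 1, p)], as [psi] is 1 at 0 and the other products contain
   a coefficient of negative index. *)
have z0 : z != 0.
  apply/eqP => z0; move: z_zero.
  rewrite z0 /root horner_coef0 coef_map coef_sum big_ltn // big1_seq.
    rewrite coefZ coefXn /= mulr1 addr0 fmorph_eq0 /Lcoef.
    rewrite big_nat big1 ?addr0; last first.
      by case=> // j _; rewrite sub0r -NegzE mul0r mulr0.
    rewrite mulf_eq0 pnatr_eq0 -leqn0 leqNgt bin_gt0 /=.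
    rewrite (_ : (p <= 2 * p - 1)%N) /=; last by lia.
    rewrite expf_eq0 /= psiE -horner_coef0 horner_prod big1 ?oner_eq0 //.
    by move=> i _; rewrite !hornerE ?mulr0 ?addr0.
  by move=> k; rewrite mem_index_iota => /andP[_ /andP[k0 _]];
    rewrite coefZ coefXn; case: k k0 => // k _; rewrite mulr0.
(* By [nz] the square root of [z] is purely imaginary, so [z] is minus the square of a real
   number. *)
have /eqP xr : 'Re (sqrtC z) == 0.
  by apply: contraT => /nz; rewrite sqrtCK eqxx.
have zE : z = - ('Im (sqrtC z)) ^+ 2.
  by rewrite -{1}(sqrtCK z) {1}[sqrtC z]Crect xr add0r exprMn sqrCi mulN1r.
have zlt : z < 0.
  rewrite zE oppr_lt0 lt0r; rewrite -oppr_eq0 -zE z0 /=.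
  by rewrite real_exprn_even_ge0 // Creal_Im.
exists (complex.Re z); last by rewrite RRe_real // ltr0_real.
by rewrite -ltcR RRe_real // ltr0_real.
Qed.
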